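(* There exists a nowhere dense class of graphs that does not have the strong Erdős–Hajnal property.
   Context: All graphs are finite, simple and undirected. The radius of a connected graph $H$ is the least integer $r$ for which some vertex of $H$ is at distance at most $r$ from every vertex of $H$. For a partition $\mathcal{X}$ of $V(G)$ into nonempty parts inducing connected subgraphs, $G/\mathcal{X}$ is the graph with vertex set $\mathcal{X}$ in which two distinct parts $X,Y$ are adjacent if $G$ has an edge with one endpoint in $X$ and the other in $Y$. A graph $H$ is a depth-$r$ minor of $G$ if $H$ is isomorphic to a subgraph of $G/\mathcal{X}$ for some partition $\mathcal{X}$ of $V(G)$ into nonempty parts inducing connected subgraphs of radius at most $r$. A class of graphs $\mathcal{C}$ is nowhere dense if for each integer $r\geq 0$ there exists a graph which is not a depth-$r$ minor of any graph from $\mathcal{C}$. For disjoint vertex subsets $A,B$ of a graph, $A$ is complete to $B$ if every vertex of $A$ is adjacent to every vertex of $B$, and $A$ is anticomplete to $B$ if there is no edge with one endpoint in $A$ and the other in $B$. A class of graphs has the strong Erdős–Hajnal property if there exists a constant $\delta>0$ such that in every $n$-vertex graph from the class with $n\geq 2$ there exist disjoint vertex subsets $A,B$, each of size at least $\delta n$, such that $A$ is either complete or anticomplete to $B$. *)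

(* Defs.v *)
From HB Require Import structures.
From mathcomp Require Import all_boot all_order all_algebra.
From mathcomp Require Import reals.
Set Implicit Arguments.
Unset Strict Implicit.
Unset Printing Implicit Defensive.

Record sgraph := SGraph {
  vertex :> finType;
  adj : rel vertex;
  adj_sym : symmetric adj;
  adj_irrefl : irreflexive adj }.

Definition isomorphic (H G : sgraph) : Prop :=
  exists2 f : H -> G, bijective f & forall x y, adj (f x) (f y) = adj x y.

Section Distance.
Variable G : sgraph.

Definition connected : bool := [forall x : G, forall y : G, connect (@adj G) x y].

Definition walk (n : nat) (x y : G) : bool :=
  [exists p : n.-tuple G, path (@adj G) x p && (last x p == y)].

(* A shortest walk has length less than #|G|, so bounding n loses nothing;
   the value is #|G| when there is no walk from x to y. *)
Definition dist (x y : G) : nat := \big[minn/#|G|]_(n < #|G| | walk n x y) n.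

(* In a nonempty connected graph all distances are less than #|G|, so some
   r < #|G| qualifies and the default value #|G| plays no role. *)
Definition radius : nat :=
  \big[minn/#|G|]_(r < #|G| | [exists c : G, forall v : G, dist c v <= r]) r.

End Distance.

Section Induced.
Variables (G : sgraph) (S : {set G}).

Definition induced_adj : rel {x : G | x \in S} :=
  fun x y => adj (val x) (val y).

Lemma induced_adj_sym : symmetric induced_adj.
Proof. by move=> x y; apply: adj_sym. Qed.

Lemma induced_adj_irrefl : irreflexive induced_adj.
Proof. by move=> x; apply: adj_irrefl. Qed.

Definition induced : sgraph := SGraph induced_adj_sym induced_adj_irrefl.

End Induced.

Section Quotient.
Variables (G : sgraph) (P : {set {set G}}).

Definition quotient_adj : rel {X : {set G} | X \in P} := fun X Y =>
  (X != Y) && [exists x in val X, exists y in val Y, adj x y].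

Lemma quotient_adj_sym : symmetric quotient_adj.
Proof.
suff sub X Y : quotient_adj X Y -> quotient_adj Y X.
  by move=> X Y; apply/idP/idP; apply: sub.
case/andP=> neqXY /exists_inP[x Xx /exists_inP[y Yy xy]].
rewrite /quotient_adj eq_sym neqXY; apply/exists_inP; exists y => //.
by apply/exists_inP; exists x; rewrite // adj_sym.
Qed.

Lemma quotient_adj_irrefl : irreflexive quotient_adj.
Proof. by move=> X; rewrite /quotient_adj eqxx. Qed.

Definition quotient_graph : sgraph :=
  SGraph quotient_adj_sym quotient_adj_irrefl.

End Quotient.

Record subgraph (G : sgraph) := Subgraph {
  sub_verts : {set G};
  sub_adj : rel G;
  sub_adj_sym : symmetric sub_adj;
  sub_adj_adj : forall x y, sub_adj x y ->
    [/\ x \in sub_verts, y \in sub_verts & adj x y] }.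

Section Subgraph.
Variables (G : sgraph) (K : subgraph G).

Definition subgraph_adj : rel {x : G | x \in sub_verts K} :=
  fun x y => sub_adj K (val x) (val y).

Lemma subgraph_adj_sym : symmetric subgraph_adj.
Proof. by move=> x y; apply: sub_adj_sym. Qed.

Lemma subgraph_adj_irrefl : irreflexive subgraph_adj.
Proof. by move=> x; apply/negP => /sub_adj_adj[_ _]; rewrite adj_irrefl. Qed.

Definition graph_of_subgraph : sgraph :=
  SGraph subgraph_adj_sym subgraph_adj_irrefl.

End Subgraph.

Coercion graph_of_subgraph : subgraph >-> sgraph.

(* The library's [partition] requires the parts to be nonempty. *)
Definition depth_minor (r : nat) (H G : sgraph) : Prop :=
  exists P : {set {set G}},
    [/\ partition P [set: G],
        forall X, X \in P -> connected (induced X) /\ radius (induced X) <= r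
      & exists K : subgraph (quotient_graph P), isomorphic H K].

Definition nowhere_dense (C : sgraph -> Prop) : Prop :=
  forall r : nat, exists H : sgraph, forall G : sgraph, C G ->
    ~ depth_minor r H G.

Definition complete_to (G : sgraph) (A B : {set G}) : Prop :=
  forall a b, a \in A -> b \in B -> adj a b.

Definition anticomplete_to (G : sgraph) (A B : {set G}) : Prop :=
  forall a b, a \in A -> b \in B -> ~~ adj a b.

Definition strong_Erdos_Hajnal (R : realType) (C : sgraph -> Prop) : Prop :=
  exists2 delta : R, (0 < delta)%R &
    forall G : sgraph, C G -> 2 <= #|G| ->
      exists A B : {set G},
        [/\ [disjoint A & B],
            (delta * #|G|%:R <= #|A|%:R)%R,
            (delta * #|G|%:R <= #|B|%:R)%R
          & complete_to A B \/ anticomplete_to A B].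

(* Main.v *)
(* For each k there is a graph G_k of girth greater than k in which any two sets
   of at least |G_k|/k vertices are joined by an edge, so that G_k has no large
   anticomplete pair, and no large complete pair as it contains no C_4 when
   k > 3.  The class consists of all graphs of order |G_k| and girth greater
   than k, for all k.
   G_k is built greedily from the edgeless graph on N vertices: only edges
   between vertices of degree less than d with no walk of length at most k
   between them are added, which keeps the girth greater than k.  Few vertices
   are saturated and balls are small, so for each large pair (A, B) a constant
   proportion of A x B stays addable; by averaging some addable edge hits a
   fixed proportion of the pairs (A, B) not joined yet, and since there are at
   most 4^N of them, O(N) edges suffice.
   The class is nowhere dense because a triangle as a depth-r minor yields a
   cycle of length at most 6r + 3, so only the bounded orders |G_k| for
   k <= 6r + 3 have to be avoided, which a large complete graph does. *)
Require Import Defs.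
From mathcomp Require Import all_boot all_order all_algebra.
From mathcomp Require Import reals zify ring.

Set Implicit Arguments.
Unset Strict Implicit.
Unset Printing Implicit Defensive.

(** The bound [2 < size c] is there since [ucycle] also accepts an edge traversed back and forth. *)
Definition girth_gt (T : eqType) (k : nat) (e : rel T) : Prop :=
  forall c : seq T, ucycle e c -> 2 < size c -> k < size c.

(** * Girth and degrees after adding an edge *)

Section AddEdge.
Variables (T : finType) (e : rel T) (u v : T).

Definition degree (x : T) : nat := #|[set y | e x y]|.

Definition add_edge : rel T := fun x y =>
  [|| e x y, (x == u) && (y == v) | (x == v) && (y == u)].

Lemma add_edge_sym : symmetric e -> symmetric add_edge.
Proof.
move=> e_sym x y; rewrite /add_edge e_sym; congr (_ || _).
by rewrite orbC ![_ && (y == _)]andbC.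
Qed.

Lemma add_edge_irrefl : u != v -> irreflexive e -> irreflexive add_edge.
Proof.
move=> uv e_irr x; rewrite /add_edge e_irr /=.
by case: (eqVneq x u) => [->|_] /=; rewrite ?(negPf uv) ?andbF.
Qed.

(** Removing the new edge from a cycle through it leaves a path of old edges between [u] and [v],
    which is longer than [k]. *)
Lemma girth_gt_add_edge k :
    symmetric e -> girth_gt k e ->
    (forall p, path e u p -> last u p = v -> k < size p) ->
  girth_gt k add_edge.
Proof.
move=> e_sym girth_e far c /andP[cyc_c uniq_c] c_gt2.
case: (boolP (all (fun x => e x (next c x)) c)) => [/allP old|].
  by apply: girth_e => //; rewrite /ucycle uniq_c (cycle_from_next uniq_c).
case/allPn => x xc new_x.
have e_xy := next_cycle cyc_c xc.
(* Rotate the cycle so that it starts with the new edge, from [x] to [y]. *)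
have [i s def_s] := rot_to xc.
have nextE : next (rot i c) x = next c x by rewrite next_rot.
have sz : size (rot i c) = size c by rewrite size_rot.
have cyc_s : cycle add_edge (rot i c) by rewrite rot_cycle.
have uniq_s : uniq (rot i c) by rewrite rot_uniq.
rewrite {}def_s in nextE sz cyc_s uniq_s.
rewrite -sz in c_gt2.
case: s => [|y p] in nextE sz cyc_s uniq_s c_gt2 *; first by [].
have yE : next c x = y by rewrite -nextE /= eqxx.
rewrite {}yE in new_x e_xy.
have xy_uv : (x == u) && (y == v) || (x == v) && (y == u).
  by move: e_xy; rewrite /add_edge (negPf new_x).
case/lastP: p => [|p z] in nextE sz cyc_s uniq_s c_gt2 *; first by [].
move: cyc_s; rewrite /= rcons_path => /and3P[_ path_p e_zx].
move: uniq_s; rewrite /= inE negb_or => /and3P[/andP[xNy xNp] yNp _].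
rewrite last_rcons in e_zx.
have zNy : z != y by apply: contraNneq yNp => <-; rewrite mem_rcons mem_head.
have zNx : z != x by apply: contraNneq xNp => <-; rewrite mem_rcons mem_head.
have old_edge a b : a != x -> b != x -> add_edge a b -> e a b.
  rewrite /add_edge.
  by case/orP: xy_uv => /andP[/eqP-> _] /negPf-> /negPf->;
    rewrite ?andbF /= ?orbF.
(* The arc from [y] back to [x] has only old edges: the earlier ones avoid [x], and the last one
   starts at [z], which is not [y]. *)
have e_path : path e y (rcons (rcons p z) x).
  rewrite rcons_path last_rcons; apply/andP; split.
    have inx : all (fun a => a != x) (y :: rcons p z).
      rewrite /= eq_sym xNy /=; apply/allP => a ap.
      by apply: contraNneq xNp => <-.
    apply: (@sub_in_path _ (fun a => a != x) _ _ _ y (rcons p z) inx path_p).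
    by move=> a b; apply: old_edge.
  move: zNx zNy e_zx; rewrite /add_edge.
  by case/orP: xy_uv => /andP[/eqP-> /eqP->] /negPf-> /negPf->;
    rewrite ?andbF /= ?orbF.
suff : k < size (rcons (rcons p z) x).
  by rewrite -sz /= !size_rcons => /leqW.
case/orP: xy_uv => /andP[/eqP xE /eqP yE]; subst x y.
  rewrite -(size_belast v) -size_rev; apply: far; last first.
    by rewrite belast_rcons /= rev_cons last_rcons.
  rewrite -[X in path e X](last_rcons v (rcons p z) u) rev_path.
  by rewrite (eq_path (e' := e)) // => a b; rewrite /= e_sym.
by apply: far e_path _; rewrite last_rcons.
Qed.

End AddEdge.

Lemma degree_add_edge (T : finType) (e : rel T) (u v x : T) :
  degree (add_edge e u v) x <= degree e x + (x == u) + (x == v).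
Proof.
have sub_nbr : [set y | add_edge e u v x y] \subset
  [set y | e x y] :|: [set y in [set v] | x == u]
    :|: [set y in [set u] | x == v].
  apply/subsetP => y; rewrite !inE /add_edge.
  by case/or3P => [->|/andP[-> ->]|/andP[-> ->]]; rewrite ?orbT.
rewrite /degree; apply: leq_trans (subset_leq_card sub_nbr) _.
have small w b : #|[set y in [set w : T] | b]| <= nat_of_bool b.
  case: b => /=.
    rewrite -(cards1 w) subset_leq_card //.
    by apply/subsetP => y; rewrite inE andbT.
  by rewrite eq_card0 // => y; rewrite !inE andbF.
apply: leq_trans (leq_card_setU _ _) _; apply: leq_add (small _ _).
by apply: leq_trans (leq_card_setU _ _) _; apply: leq_add (leqnn _) (small _ _).
Qed.

(** * Balls under a degree bound *)

Section Ball.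
Variables (T : finType) (e : rel T).

Fixpoint ball (n : nat) (x : T) : {set T} :=
  if n is m.+1 then \bigcup_(y in x |: [set y | e x y]) ball m y else [set x].

Lemma mem_ball_center n x : x \in ball n x.
Proof.
elim: n => [|n IHn] /=; first exact: set11.
by apply/bigcupP; exists x; rewrite // setU11.
Qed.

Lemma mem_ball_last n x p : path e x p -> size p <= n -> last x p \in ball n x.
Proof.
elim: p x n => [|y p IHp] x n /=; first by rewrite mem_ball_center.
case: n => // n /andP[exy ep] sz; apply/bigcupP; exists y.
  by rewrite !inE exy orbT.
exact: IHp.
Qed.

Lemma card_ball n d x : (forall y, degree e y <= d) -> #|ball n x| <= d.+1 ^ n.
Proof.
move=> deg_le; elim: n x => [|n IHn] x /=; first by rewrite cards1.
have sumle : #|\bigcup_(y in x |: [set y | e x y]) ball n y|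
    <= \sum_(y in x |: [set y | e x y]) #|ball n y|.
  elim/big_ind2: _ => [|A a B b leA leB|//]; first by rewrite cards0.
  by apply: leq_trans (leq_card_setU _ _) _; apply: leq_add.
apply: leq_trans sumle _.
apply: (@leq_trans (\sum_(y in x |: [set y | e x y]) d.+1 ^ n)).
  by apply: leq_sum.
rewrite sum_nat_const expnS leq_mul2r; apply/orP; right.
by rewrite cardsU1; apply: leq_add (leq_b1 _) (deg_le x).
Qed.

End Ball.

(** * Double counting *)

Lemma card_dep_pairs (I J : finType) (F : I -> {set J}) :
  #|[set p | p.2 \in F p.1]| = \sum_i #|F i|.
Proof.
under eq_bigr => i _ do rewrite -sum1_card.
rewrite pair_big_dep /= -sum1_card.
by apply: eq_bigl => p; rewrite inE.
Qed.

(** Averaging over [Y], multiplied out to avoid division. Since [c] is positive, any member of [X]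
    shows that [Y] is nonempty. *)
Lemma double_count_le (I J : finType) (X : {set I}) (Y : {set J})
    (r : I -> J -> bool) (c : nat) :
    0 < c -> X != set0 ->
    (forall x, x \in X -> c <= #|[set y in Y | r x y]|) ->
  exists2 y, y \in Y & #|X| * c <= #|Y| * #|[set x in X | r x y]|.
Proof.
move=> c_gt0 /set0Pn[x0 Xx0] hc.
apply/exists_inP; apply: contraT; rewrite negb_exists_in => /forall_inP few.
have count_swap : \sum_(y in Y) #|[set x in X | r x y]|
    = \sum_(x in X) #|[set y in Y | r x y]|.
  under eq_bigr => y _ do rewrite -sum1_card.
  under [RHS]eq_bigr => x _ do rewrite -sum1_card.
  rewrite (exchange_big_dep (mem X)) /=; last first.
    by move=> y x _; rewrite inE => /andP[].
  apply: eq_bigr => x Xx; apply: eq_bigl => y.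
  by rewrite !inE Xx /=.
have : \sum_(x in X) c <= \sum_(y in Y) #|[set x in X | r x y]|.
  by rewrite count_swap; apply: leq_sum.
rewrite sum_nat_const => le_sum.
have Y_gt0 : 0 < #|Y|.
  have /card_gt0P[y] := leq_trans c_gt0 (hc _ Xx0).
  by rewrite inE => /andP[Yy _]; apply/card_gt0P; exists y.
have : \sum_(y in Y) (#|Y| * #|[set x in X | r x y]|).+1
    <= \sum_(y in Y) #|X| * c.
  by apply: leq_sum => y Yy; rewrite ltnNge few.
under eq_bigr => y _ do rewrite -addn1.
rewrite big_split /= -big_distrr /= !sum_nat_const muln1 leqNgt => /negP[].
apply: (@leq_trans (#|Y| * (#|X| * c)).+1) => //.
by rewrite -addn1; apply: leq_add => //; rewrite leq_mul2l le_sum orbT.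
Qed.

(** * The greedy construction *)

Section Greedy.
Variables (T : finType) (k d : nat).
Implicit Type e : rel T.

Definition large_empty_pairs e : {set {set T} * {set T}} :=
  [set AB : {set T} * {set T} | [&& #|T| <= k * #|AB.1|, #|T| <= k * #|AB.2|
              & [forall a in AB.1, forall b in AB.2, ~~ e a b]]].

(** The degree conditions keep all degrees at most [d]; the ball condition keeps the girth above [k]
    and rules out loops. *)
Definition addable e : {set T * T} :=
  [set p | [&& degree e p.1 < d, degree e p.2 < d & p.2 \notin ball e k p.1]].

(** Discarding the saturated vertices leaves at least [m] in each of [A] and [B]. A remaining pair
    can only fail to be addable by lying within distance [k], and the balls bound the number of such
    pairs. *)
Lemma card_addable_in e (A B : {set T}) m :
    (forall x, degree e x <= d) -> #|[set x | d <= degree e x]| <= m ->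
    2 * m <= #|A| -> 2 * m <= #|B| ->
  m * m <= #|addable e :&: setX A B| + #|T| * d.+1 ^ k.
Proof.
set S := [set x | _] => deg_le leS leA leB.
have big_diff (C : {set T}) : 2 * m <= #|C| -> m <= #|C :\: S|.
  move=> leC; have := cardsID S C.
  have := subset_leq_card (subsetIr C S); lia.
have sub_pairs : setX (A :\: S) (B :\: S)
    \subset (addable e :&: setX A B) :|: [set p | p.2 \in ball e k p.1].
  apply/subsetP => -[a b]; rewrite !inE /= -!ltnNge.
  move=> /andP[/andP[-> ->] /andP[-> ->]] /=.
  by case: (b \in _).
apply: (@leq_trans #|setX (A :\: S) (B :\: S)|).
  by rewrite cardsX leq_mul ?big_diff.
apply: leq_trans (subset_leq_card sub_pairs) _.
apply: leq_trans (leq_card_setU _ _) _; rewrite leq_add2l card_dep_pairs.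
rewrite -sum_nat_const; apply: leq_sum => x _.
exact: card_ball.
Qed.

Lemma card_saturated e : #|[set x | d <= degree e x]| * d <= \sum_x degree e x.
Proof.
rewrite -sum_nat_const.
rewrite [X in _ <= X](bigID (fun x => d <= degree e x)) /=.
apply: leq_trans (leq_addr _ _).
under eq_bigl => x do rewrite inE.
exact: leq_sum.
Qed.

(** Here [t] bounds the number of edges; the degree sum serves to bound the number of saturated
    vertices. *)
Definition good_graph t e :=
  [/\ symmetric e, irreflexive e, girth_gt k e,
      forall x, degree e x <= d & \sum_x degree e x <= 2 * t].

Lemma good_graph_add_edge t e u v :
  good_graph t e -> (u, v) \in addable e -> good_graph t.+1 (add_edge e u v).
Proof.
case=> e_sym e_irr girth_e deg_e sum_e.
rewrite inE /= => /and3P[deg_u deg_v far].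
have uv : u != v by apply: contraNneq far => ->; apply: mem_ball_center.
split.
- exact: add_edge_sym.
- exact: add_edge_irrefl.
- apply: girth_gt_add_edge => // p ep pv; rewrite ltnNge; apply: contra far.
  by rewrite -pv; apply: mem_ball_last.
- move=> x; apply: leq_trans (degree_add_edge _ _ _ _) _.
  have := deg_e x; case: (eqVneq x u) => [->|_].
    by rewrite (negPf uv); lia.
  by case: (eqVneq x v) => [->|_]; lia.
- apply: (@leq_trans (\sum_x (degree e x + (x == u) + (x == v)))).
    by apply: leq_sum => x _; apply: degree_add_edge.
  have sum1 w : \sum_(x : T) (x == w : nat) = 1.
    by rewrite (bigD1 w) //= eqxx big1 // => x /negPf->.
  by rewrite !big_split /= !sum1; lia.
Qed.

(** Every large empty pair contains at least m^2/2 of the at most |T|^2 = 4 k^2 m^2 addable pairs,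
    so by averaging some addable edge hits a fraction 1/(8 k^2) = 1/q of them. *)
Lemma exists_reducing_edge t e m q :
    good_graph t e -> #|T| = 2 * k * m -> 0 < k -> 0 < d ->
    2 * t <= m * d -> 4 * k * d.+1 ^ k < m -> q = 8 * k * k ->
    large_empty_pairs e != set0 ->
  exists2 p, p \in addable e &
    q * #|large_empty_pairs (add_edge e p.1 p.2)|
      <= q.-1 * #|large_empty_pairs e|.
Proof.
move=> [e_sym e_irr girth_e deg_e sum_e].
move=> cardT k_gt0 d_gt0 t_le m_gt q_def nonempty.
have leS : #|[set x | d <= degree e x]| <= m.
  by have := leq_trans (card_saturated e) (leq_trans sum_e t_le);
    rewrite leq_pmul2r.
set X := large_empty_pairs e in nonempty *.
pose r (AB : {set T} * {set T}) (p : T * T) := p \in setX AB.1 AB.2.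
pose c := m * m - #|T| * d.+1 ^ k.
(* The loss 2 k m (d+1)^k is less than m^2/2 by the lower bound on [m]. *)
have c_gt : m * m <= 2 * c.
  have : m * (4 * k * d.+1 ^ k) <= m * m by rewrite leq_mul2l (ltnW m_gt) orbT.
  rewrite /c cardT; set b := d.+1 ^ k; nia.
have m_gt0 : 0 < m by lia.
have c_gt0 : 0 < c by have : 0 < m * m; [rewrite muln_gt0 m_gt0 | lia].
have [AB|[u v] addable_uv hit] :=
    @double_count_le _ _ X (addable e) r c c_gt0 nonempty.
  rewrite inE => /and3P[leA leB _].
  rewrite leq_subLR addnC.
  have -> : [set y in addable e | r AB y] = addable e :&: setX AB.1 AB.2.
    by apply/setP => y; rewrite !inE.
  have large_m (C : {set T}) : #|T| <= k * #|C| -> 2 * m <= #|C|.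
    by rewrite cardT mulnAC mulnC leq_pmul2l.
  by apply: card_addable_in => //; apply: large_m.
exists (u, v) => //=.
set X' := large_empty_pairs _.
set H := [set x in X | _] in hit.
have sub_X : X' \subset X :\: H.
  apply/subsetP => -[A B]; rewrite !inE /= /r /=.
  case/and3P=> -> -> /forall_inP empty; rewrite /= andbC; apply/andP; split.
    apply/forall_inP => a Aa; apply/forall_inP => b Bb.
    by have /forall_inP/(_ b Bb) := empty a Aa; rewrite negb_or => /andP[].
  apply/negP => /andP[_]; rewrite inE /= => /andP[Au Bv].
  have /forall_inP/(_ v Bv) := empty u Au.
  by rewrite /add_edge !eqxx orbT.
have := cardsID H X; have := subset_leq_card sub_X.
have -> : X :&: H = H by apply/setIidPr/subsetP => x; rewrite inE => /andP[].
have card_addable : #|addable e| <= #|T| * #|T| by rewrite -card_prod max_card.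
move=> leX' splitX.
have leXH : #|X| <= q * #|H|.
  have : #|X| * (m * m) <= q * #|H| * (m * m).
    apply: (@leq_trans (2 * (#|X| * c))).
      by rewrite (mulnCA 2) leq_mul2l c_gt orbT.
    apply: (@leq_trans (2 * (#|T| * #|T| * #|H|))).
      rewrite leq_mul2l; apply: leq_trans hit _.
      by rewrite leq_mul2r card_addable orbT.
    by rewrite cardT q_def leq_eqVlt; apply/orP; left; apply/eqP; ring.
  by rewrite leq_pmul2r // muln_gt0 m_gt0.
have : q * #|X'| <= q * #|X| - q * #|H|.
  by rewrite -mulnBr leq_mul2l; apply/orP; right; lia.
by move/leq_trans; apply; rewrite -subn1 mulnBl mul1n leq_sub2l.
Qed.

(** The edgeless graph has at most 4^|T| large empty pairs, and each step multiplies their number by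
    at most (q-1)/q. *)
Lemma exists_reduced_graph t m q :
    #|T| = 2 * k * m -> 0 < k -> 0 < d ->
    2 * t <= m * d -> 4 * k * d.+1 ^ k < m -> q = 8 * k * k ->
  exists2 e, good_graph t e &
    #|large_empty_pairs e| * q ^ t <= 2 ^ (2 * #|T|) * q.-1 ^ t.
Proof.
move=> cardT k_gt0 d_gt0 t_le m_gt q_def.
elim: t t_le => [|t IHt] t_le.
  exists (fun _ _ => false).
    have deg0 (x : T) : degree (fun _ _ => false) x = 0.
      by apply: eq_card0 => y; rewrite inE.
    split=> // [[|x [|y c]] //= | x | ]; first by rewrite deg0.
    by rewrite big1.
  rewrite !muln1 mul2n -addnn expnD.
  have <- : #|{set T}| = 2 ^ #|T|.
    rewrite -!cardsT -card_powerset; congr #|pred_of_set _|.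
    by apply/setP => A; rewrite !inE subsetT.
  by rewrite -card_prod max_card.
have [|e good_e le_e] := IHt; first by lia.
(* Once no pair is left, the graph is kept unchanged. *)
have [empty|nonempty] := eqVneq (large_empty_pairs e) set0.
  exists e; last by rewrite empty cards0 mul0n.
  by case: good_e => ? ? ? ? le_sum; split=> //; lia.
have t_le' : 2 * t <= m * d by lia.
have [[u v] uv_add red] :=
  exists_reducing_edge good_e cardT k_gt0 d_gt0 t_le' m_gt q_def nonempty.
exists (add_edge e u v); first exact: good_graph_add_edge.
rewrite !expnS; move: red le_e => /=.
move: #|large_empty_pairs e| #|large_empty_pairs _| => X X' red le_e.
have : q * X' * q ^ t <= q.-1 * X * q ^ t by rewrite leq_mul2r red orbT.
have : q.-1 * (X * q ^ t) <= q.-1 * (2 ^ (2 * #|T|) * q.-1 ^ t).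
  by rewrite leq_mul2l le_e orbT.
move: (q ^ t) (q.-1 ^ t) (2 ^ _) => a b P; lia.
Qed.

End Greedy.

(** * High girth without large empty pairs *)

Lemma double_pred_expn q : 0 < q -> 2 * q.-1 ^ q <= q ^ q.
Proof.
(* Expand (1 + q)^(q+1): each of the last two binomial terms is at least q^(q+1). *)
case: q => // q _; rewrite /= -[X in _ <= X ^ _]add1n expnDn.
rewrite big_ord_recr [X in _ <= X + _]big_ord_recr /=.
rewrite subnn subSnn !exp1n binn binSn !mul1n expnS; lia.
Qed.

(* With N = 2 k m vertices, a set of at least N/k vertices has at least 2m of
   them.  The degree bound is such that the q (2N + 1) edges added, where
   q = 8 k^2, saturate at most m vertices. *)
Definition hole_degree k := 96 * k ^ 3.
Definition hole_scale k := (4 * k * (hole_degree k).+1 ^ k).+1.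
Definition hole_order k := 2 * k * hole_scale k.

(** Every [q] steps at least halve the bound on the number of empty pairs, so q (2N + 1) steps bring
    it from 2^(2N) below 1. *)
Lemma exists_high_girth_no_hole k : 0 < k ->
  exists e : rel 'I_(hole_order k),
    [/\ symmetric e, irreflexive e, girth_gt k e &
    forall A B : {set 'I_(hole_order k)},
      hole_order k <= k * #|A| -> hole_order k <= k * #|B| ->
      exists a b, [/\ a \in A, b \in B & e a b]].
Proof.
move=> k_gt0; set N := hole_order k; set q := 8 * k * k.
have q_gt0 : 0 < q by rewrite /q; nia.
have cardT : #|'I_N| = 2 * k * hole_scale k by rewrite card_ord.
have [|||e [e_sym e_irr girth_e _ _]] :=
    @exists_reduced_graph 'I_N k (hole_degree k) (q * (2 * N).+1) _ q
      cardT k_gt0 _ _ _ erefl.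
- by rewrite /hole_degree muln_gt0 expn_gt0 k_gt0.
- rewrite /N /q /hole_order /hole_degree.
  have : 0 < k * hole_scale k by rewrite muln_gt0 k_gt0.
  set m := hole_scale k => km_gt0.
  (* The [1] in 2N + 1 is bounded by k m; the left side is then 80 k^3 m. *)
  have : 2 * (8 * k * k * (2 * (2 * k * m) + k * m)) <= m * (96 * k ^ 3).
    by rewrite !expnS; nia.
  by apply: leq_trans; rewrite leq_mul2l /= leq_mul2l; apply/orP; right; lia.
- by [].
rewrite card_ord => small.
have pairs0 : #|large_empty_pairs k e| = 0.
  apply/eqP; apply: contraT; rewrite -lt0n => pos.
  have pow : 2 ^ (2 * N).+1 * q.-1 ^ (q * (2 * N).+1) <= q ^ (q * (2 * N).+1).
    by rewrite !(expnM _ q) -expnMn leq_exp2r // double_pred_expn.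
  have pred_gt0 : 0 < 2 ^ (2 * N) * q.-1 ^ (q * (2 * N).+1).
    rewrite muln_gt0 !expn_gt0 /= -subn1 subn_gt0.
    by apply/orP; left; rewrite /q; nia.
  have le_mul : q ^ (q * (2 * N).+1)
      <= #|large_empty_pairs k e| * q ^ (q * (2 * N).+1).
    by rewrite leq_pmull.
  have := leq_trans pow (leq_trans le_mul small).
  by rewrite (expnS 2) -mulnA mul2n -addnn leqNgt -[X in X < _]addn0
    ltn_add2l pred_gt0.
exists e; split=> // A B leA leB.
have : (A, B) \notin large_empty_pairs k e by rewrite (cards0_eq pairs0) inE.
rewrite inE /= card_ord leA leB /= negb_forall_in => /exists_inP[a Aa].
rewrite negb_forall_in => /exists_inP[b Bb]; rewrite negbK => eab.
by exists a, b.
Qed.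

(** * Short paths in graphs of small radius *)

Lemma bigmin_leq (d r : nat) (P : pred 'I_d) :
  \big[minn/d]_(n < d | P n) n <= r -> d <= r \/ exists2 n : 'I_d, P n & n <= r.
Proof.
apply: (big_ind (fun m => m <= r -> d <= r \/ exists2 n : 'I_d, P n & n <= r)).
- by left.
- by move=> m n IHm IHn; rewrite geq_min => /orP[/IHm|/IHn].
- by move=> n Pn le_nr; right; exists n.
Qed.

Section ShortPaths.
Variable G : sgraph.

Lemma connected_uniq_path : connected G -> forall x y : G,
  exists p, [/\ path (@adj G) x p, last x p = y & uniq (x :: p)].
Proof.
move=> /forallP conn x y; have /forallP/(_ y)/connectP[p pth ->] := conn x.
by case/shortenP: pth => q pth_q uniq_q _; exists q.
Qed.

Lemma path_dist_leq (x y : G) r :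
  connected G -> dist x y <= r ->
  exists p, [/\ path (@adj G) x p, last x p = y & size p <= r].
Proof.
move=> conn /bigmin_leq[le_r|[n /existsP[p /andP[pth /eqP last_p]] le_nr]].
  (* The default value of [dist]: here [r] is at least the order, which bounds the length of any
     duplicate-free path. *)
  have [p [pth last_p uniq_p]] := connected_uniq_path conn x y.
  exists p; split=> //; apply: leq_trans le_r.
  by have := max_card (mem (x :: p)); rewrite (card_uniqP uniq_p) => /ltnW.
by exists p; rewrite size_tuple.
Qed.

(** Go from [x] to a centre and on to [y], then shorten to remove repeated vertices. *)
Lemma path_radius_leq r : connected G -> radius G <= r -> forall x y : G,
  exists p, [/\ path (@adj G) x p, last x p = y, uniq (x :: p) &
    size p <= 2 * r].
Proof.
move=> conn /bigmin_leq[le_r x y|[n /existsP[c /forallP near_c] le_nr] x y].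
  have [p [pth last_p uniq_p]] := connected_uniq_path conn x y.
  exists p; split=> //; apply: (@leq_trans #|G|); last by lia.
  by have := max_card (mem (x :: p)); rewrite (card_uniqP uniq_p) => /ltnW.
have [p [pth_p last_p size_p]] := path_dist_leq conn (near_c x).
have [q [pth_q last_q size_q]] := path_dist_leq conn (near_c y).
have pth_rev : path (@adj G) x (rev (belast c p)).
  rewrite -last_p rev_path (eq_path (e' := @adj G)) // => a b.
  by rewrite adj_sym.
have last_rev : last x (rev (belast c p)) = c.
  case: (p) last_p => [|z s] last_s; first by rewrite -last_s.
  by rewrite rev_cons last_rcons.
have pth : path (@adj G) x (rev (belast c p) ++ q).
  by rewrite cat_path pth_rev last_rev.
have last_pq : last x (rev (belast c p) ++ q) = y by rewrite last_cat last_rev.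
have size_pq : size (rev (belast c p) ++ q) <= 2 * r.
  by rewrite size_cat size_rev size_belast; lia.
rewrite -last_pq; case/shortenP: pth => s pth_s uniq_s sub_s.
exists s; split=> //; apply: leq_trans size_pq.
by have /andP[_ uniq_s'] := uniq_s; apply: uniq_leq_size.
Qed.

End ShortPaths.

(** * Complete graphs as shallow minors *)

Lemma induced_path (G : sgraph) (X : {set G}) r (x y : G) :
    connected (induced X) -> radius (induced X) <= r -> x \in X -> y \in X ->
  exists p, [/\ path (@adj G) x p, last x p = y, uniq (x :: p),
    size p <= 2 * r & {subset x :: p <= X}].
Proof.
move=> conn rad Xx Xy.
have [p [pth last_p uniq_p size_p]] :=
  path_radius_leq conn rad (exist _ x Xx) (exist _ y Xy).
exists (map val p); split.
- by rewrite -[x]/(val (exist (fun z => z \in X) x Xx)) path_map.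
- by rewrite -[x]/(val (exist (fun z => z \in X) x Xx)) last_map last_p.
- rewrite -[x]/(val (exist (fun z => z \in X) x Xx)) -map_cons.
  by rewrite map_inj_uniq //; apply: val_inj.
- by rewrite size_map.
- move=> z; rewrite inE => /predU1P[->//|/mapP[w _ ->]]; exact: valP.
Qed.

(** The three paths and the linking edges form a cycle, duplicate-free because the sets are
    disjoint. *)
Lemma girth_gt_no_triangle (T : finType) (e : rel T) (k : nat) (X Y Z : {set T})
    (a1 a2 a3 : T) (p1 p2 p3 : seq T) :
    girth_gt k e -> [disjoint X & Y] -> [disjoint X & Z] -> [disjoint Y & Z] ->
    [/\ path e a1 p1, uniq (a1 :: p1) & {subset a1 :: p1 <= X}] ->
    [/\ path e a2 p2, uniq (a2 :: p2) & {subset a2 :: p2 <= Y}] ->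
    [/\ path e a3 p3, uniq (a3 :: p3) & {subset a3 :: p3 <= Z}] ->
    e (last a1 p1) a2 -> e (last a2 p2) a3 -> e (last a3 p3) a1 ->
  k < size p1 + size p2 + size p3 + 3.
Proof.
move=> girth XY XZ YZ [pth1 uniq1 sub1] [pth2 uniq2 sub2] [pth3 uniq3 sub3].
move=> e12 e23 e31.
have disj (A B : {set T}) (s t : seq T) : [disjoint A & B] ->
    {subset s <= A} -> {subset t <= B} -> has (mem s) t = false.
  move=> AB sA tB; apply/negbTE/hasPn => z /tB Bz; apply/negP => /sA Az.
  by have := disjointFr AB Az; rewrite Bz.
have := girth ((a1 :: p1) ++ (a2 :: p2) ++ (a3 :: p3)).
rewrite !size_cat /= => far.
suff : k < (size p1).+1 + ((size p2).+1 + (size p3).+1) by clear; lia.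
apply: far; last by clear; lia.
apply/andP; split.
  rewrite /= rcons_cat cat_path pth1 /= e12 rcons_cat cat_path pth2 /= e23.
  by rewrite rcons_path pth3.
rewrite -[uniq _]/(uniq ((a1 :: p1) ++ (a2 :: p2) ++ a3 :: p3)).
rewrite !cat_uniq uniq1 uniq2 uniq3 has_cat.
by rewrite (disj _ _ _ _ XY) // (disj _ _ _ _ XZ) // (disj _ _ _ _ YZ).
Qed.

Definition complete_adj (t : nat) : rel 'I_t := fun i j => i != j.

Lemma complete_adj_sym t : symmetric (@complete_adj t).
Proof. by move=> i j; rewrite /complete_adj eq_sym. Qed.

Lemma complete_adj_irrefl t : irreflexive (@complete_adj t).
Proof. by move=> i; rewrite /complete_adj eqxx. Qed.

Definition complete_graph (t : nat) : sgraph :=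
  SGraph (@complete_adj_sym t) (@complete_adj_irrefl t).

Lemma complete_depth_minor t r (G : sgraph) :
  depth_minor r (complete_graph t) G ->
  exists P : {set {set G}}, [/\ partition P [set: G],
    forall X, X \in P -> connected (induced X) /\ radius (induced X) <= r &
    exists f : 'I_t -> {set G}, [/\ injective f, forall i, f i \in P &
      forall i j, i != j -> exists x y, [/\ x \in f i, y \in f j & adj x y]]].
Proof.
case=> P [partP smallP [K [f bij_f adj_f]]].
exists P; split=> //; exists (fun i => val (val (f i))); split.
- by move=> i j /val_inj/val_inj; apply: bij_inj.
- by move=> i; apply: valP.
- move=> i j ij; have : adj (f i) (f j) by rewrite adj_f.
  case/sub_adj_adj => _ _ /andP[_ /exists_inP[x fx /exists_inP[y fy xy]]].
  by exists x, y.
Qed.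

Lemma complete_depth_minor_leq t r (G : sgraph) :
  depth_minor r (complete_graph t) G -> t <= #|G|.
Proof.
case/complete_depth_minor => P [partP _ [f [inj_f fP _]]].
rewrite -[t]card_ord -(card_imset _ inj_f).
apply: (@leq_trans #|P|).
  by apply: subset_leq_card; apply/subsetP => _ /imsetP[i _ ->].
rewrite -cardsT (card_partition partP) -sum1_card.
apply: leq_sum => X PX; rewrite card_gt0.
by have /and3P[_ _] := partP; apply: contraNneq => <-.
Qed.

Lemma girth_gt_no_complete_minor t r (G : sgraph) :
  2 < t -> girth_gt (6 * r + 3) (@adj G) ->
  ~ depth_minor r (complete_graph t) G.
Proof.
move=> t_gt2 girth /complete_depth_minor[P [partP smallP [f [inj_f fP adj_f]]]].
have t_gt0 : 0 < t by lia. have t_gt1 : 1 < t by lia.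
pose i0 := Ordinal t_gt0; pose i1 := Ordinal t_gt1; pose i2 := Ordinal t_gt2.
(* The cycle enters the three parts at [y1], [y2], [y3] and leaves them at [x1], [x2], [x3]. *)
have [x1 [y2 [fx1 fy2 e12]]] := adj_f i0 i1 isT.
have [x2 [y3 [fx2 fy3 e23]]] := adj_f i1 i2 isT.
have [x3 [y1 [fx3 fy1 e31]]] := adj_f i2 i0 isT.
have disj i j : i != j -> [disjoint f i & f j].
  move=> ij; have /and3P[_ /trivIsetP triv _] := partP.
  by apply: triv; rewrite ?fP // (inj_eq inj_f).
have link i x y : x \in f i -> y \in f i -> exists p,
    [/\ path (@adj G) x p, last x p = y, uniq (x :: p), size p <= 2 * r &
      {subset x :: p <= f i}].
  by move=> fx fy; have [conn rad] := smallP _ (fP i); apply: induced_path.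
have [p1 [pth1 last1 uniq1 size1 sub1]] := link _ _ _ fy1 fx1.
have [p2 [pth2 last2 uniq2 size2 sub2]] := link _ _ _ fy2 fx2.
have [p3 [pth3 last3 uniq3 size3 sub3]] := link _ _ _ fy3 fx3.
have := @girth_gt_no_triangle _ _ _ (f i0) (f i1) (f i2) _ _ _ p1 p2 p3 girth
  (disj i0 i1 isT) (disj i0 i2 isT) (disj i1 i2 isT) (And3 pth1 uniq1 sub1)
  (And3 pth2 uniq2 sub2) (And3 pth3 uniq3 sub3).
by rewrite last1 last2 last3 => /(_ e12 e23 e31);
  clear -size1 size2 size3; lia.
Qed.

(** Describing the class by order and girth avoids choosing one graph for each [k]. *)
Definition high_girth_graphs (G : sgraph) : Prop :=
  exists k, #|G| = hole_order k /\ girth_gt k (@adj G).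

Lemma nowhere_dense_high_girth : nowhere_dense high_girth_graphs.
Proof.
move=> r; set s := (6 * r + 3).+1.
(* The sum plus 3 exceeds each order [hole_order k] with [k < s], and the 3 guarantees a triangle
   for the remaining [k]. *)
exists (complete_graph (\sum_(k < s) hole_order k + 3)) => G [k [cardG girth]].
have [small|large] := ltnP k s.
  move/complete_depth_minor_leq; rewrite cardG (bigD1 (Ordinal small)) //=.
  lia.
apply: girth_gt_no_complete_minor; first by lia.
by move=> c cyc_c c_gt2; apply: leq_trans (girth c cyc_c c_gt2); apply: ltnW.
Qed.

(** * Excluding large homogeneous pairs *)

Lemma girth_gt_complete_to (G : sgraph) (A B : {set G}) k :
    3 < k -> girth_gt k (@adj G) -> [disjoint A & B] -> complete_to A B ->
  #|A| <= 1 \/ #|B| <= 1.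
Proof.
move=> k_gt3 girth AB compl.
case: (leqP #|A| 1) => [|/card_gt1P[a1 [a2 [Aa1 Aa2 a12]]]]; first by left.
case: (leqP #|B| 1) => [|/card_gt1P[b1 [b2 [Bb1 Bb2 b12]]]]; first by right.
have ABneq a b : a \in A -> b \in B -> a != b.
  by move=> Aa Bb; apply: contraTneq Bb => <-; rewrite (disjointFr AB Aa).
(* Two vertices on each side would form a 4-cycle. *)
have : k < size [:: a1; b1; a2; b2]; last by rewrite ltnNge k_gt3.
apply: girth => //; apply/andP; split.
  by rewrite /= !(adj_sym b1) !(adj_sym b2) !compl.
by rewrite /= !inE !negb_or a12 b12 (eq_sym b1 a2) !ABneq.
Qed.

Import Order.TTheory GRing.Theory Num.Theory.

Theorem proposition5 (R : realType) :
  exists C : sgraph -> Prop, nowhere_dense C /\ ~ strong_Erdos_Hajnal R C.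
Proof.
exists high_girth_graphs; split; first exact: nowhere_dense_high_girth.
case=> delta delta_gt0 hasAB.
(* This [k] is at least 1/delta, and the 4 makes it exceed 3, which excludes 4-cycles. *)
pose k := (Num.truncn delta^-1 + 4)%N.
have k_gt0 : 0 < k by rewrite /k; lia.
have large_k N n : (delta * N%:R <= n%:R)%R -> N <= k * n.
  move=> le_n; rewrite -(ler_nat R) natrM.
  have inv_le : (delta^-1 <= k%:R)%R.
    apply: ltW; apply: lt_le_trans (truncnS_gt _) _.
    by rewrite ler_nat -addn1 leq_add2l.
  apply: (@le_trans _ _ (delta^-1 * n%:R)%R).
    by rewrite ler_pdivlMl.
  by rewrite ler_wpM2r.
have [e [e_sym e_irr girth_e no_hole]] := exists_high_girth_no_hole k_gt0.
pose G := SGraph e_sym e_irr.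
have cardG : #|G| = hole_order k by rewrite card_ord.
have order_ge : 2 * k <= hole_order k by rewrite leq_pmulr.
have [||A [B [AB /large_k leA /large_k leB homog]]] := hasAB G.
- by exists k.
- by rewrite cardG; lia.
rewrite cardG in leA leB.
case: homog => [compl|anti]; last first.
  have [a [b [Aa Bb eab]]] := no_hole A B leA leB.
  by have := anti a b Aa Bb; rewrite /= eab.
have k_gt3 : 3 < k by rewrite /k; lia.
(* As the order is at least 2k, each large set has two vertices. *)
have two (C : {set G}) : hole_order k <= k * #|C| -> 1 < #|C|.
  by move=> leC; rewrite -(leq_pmul2l k_gt0) mulnC; apply: leq_trans leC.
have [] := @girth_gt_complete_to G A B k k_gt3 girth_e AB compl.
  by rewrite leqNgt two.
by rewrite leqNgt two.
Qed.
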